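(* Let $G=(V,E)$ be a finite, simple, undirected, connected, unweighted graph with $n\ge2$ nodes and $m$ edges, and let $v\in V$; label the nodes so that $v$ is the last node. Let $\mathcal{L}=I-D^{-1/2}AD^{-1/2}$ be the normalized Laplacian and $\mathcal{L}_v$ the $(n-1)\times(n-1)$ submatrix obtained by deleting the row and column of $v$. Let $\boldsymbol{\pi}(u)=d_u/(2m)$, let $\boldsymbol{\pi}_v\in\mathbb{R}^{n-1}$ be $\boldsymbol{\pi}$ with the entry of $v$ deleted, and let $\sqrt{\boldsymbol{\pi}_v}$ be its entrywise square root. Then $\mathcal{L}_v$ is invertible and $$\mathcal{L}^\dagger=\begin{pmatrix} I-\sqrt{\boldsymbol{\pi}_v}\sqrt{\boldsymbol{\pi}_v}^T \\ -\sqrt{\boldsymbol{\pi}(v)}\sqrt{\boldsymbol{\pi}_v}^T\end{pmatrix}\mathcal{L}_v^{-1}\begin{pmatrix} I-\sqrt{\boldsymbol{\pi}_v}\sqrt{\boldsymbol{\pi}_v}^T & -\sqrt{\boldsymbol{\pi}(v)}\sqrt{\boldsymbol{\pi}_v}\end{pmatrix},$$ with $I$ the $(n-1)\times(n-1)$ identity.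
   Context: $A$ is the adjacency matrix, $D$ the diagonal degree matrix with entries $d_u$, and $\mathcal{L}^\dagger$ the Moore–Penrose pseudo-inverse of $\mathcal{L}$. *)

(* Defs.v *)
From HB Require Import structures.
From mathcomp Require Import all_boot all_order all_algebra.

Set Implicit Arguments.
Unset Strict Implicit.
Unset Printing Implicit Defensive.

Import Order.TTheory GRing.Theory Num.Theory.
Local Open Scope ring_scope.

Section MoorePenrose.
Variable R : realFieldType.

(* The four Penrose conditions; the field is real, so the conjugate
   transpose is the transpose. *)
Definition penrose m n (A : 'M[R]_(m, n)) (X : 'M[R]_(n, m)) : bool :=
  [&& A *m X *m A == A,
      X *m A *m X == X,
      (A *m X)^T == A *m X
    & (X *m A)^T == X *m A].

Lemma penroseP m n (A : 'M[R]_(m, n)) (X : 'M[R]_(n, m)) :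
  reflect [/\ A *m X *m A = A, X *m A *m X = X,
              (A *m X)^T = A *m X & (X *m A)^T = X *m A]
          (penrose A X).
Proof.
by apply: (iffP and4P) => -[/eqP-> /eqP-> /eqP-> /eqP->].
Qed.

Lemma mul_trmx_eq0 n (u : 'rV[R]_n) : u *m u^T = 0 -> u = 0.
Proof.
move/matrixP/(_ 0 0); rewrite !mxE => /eqP.
rewrite psumr_eq0 => [/allP u0|i _]; last by rewrite mxE -expr2 sqr_ge0.
apply/rowP => i; have := u0 i; rewrite mem_index_enum => /(_ isT) /=.
by rewrite !mxE mulf_eq0 orbb => /eqP.
Qed.

Lemma gram_unitmx m n (F : 'M[R]_(m, n)) : row_free F -> F *m F^T \in unitmx.
Proof.
move=> Ffree; rewrite -row_free_unit -kermx_eq0; apply/eqP/row_matrixP => i.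
rewrite row0; apply: (row_free_inj Ffree); rewrite mul0mx.
apply: mul_trmx_eq0; rewrite trmx_mul !mulmxA.
have := mulmx_ker (F *m F^T); move/(congr1 (row i)).
by rewrite row_mul row0 !mulmxA => ->; rewrite mul0mx.
Qed.

Lemma penrose_exists m n (A : 'M[R]_(m, n)) : exists X, penrose A X.
Proof.
pose C := col_base A; pose F := row_base A.
have uF : F *m F^T \in unitmx by apply/gram_unitmx/row_base_free.
have uC : C^T *m C \in unitmx.
  rewrite -{2}[C]trmxK; apply: gram_unitmx.
  by rewrite -row_leq_rank mxrank_tr (eqP (col_base_full A)).
have AE : A = C *m F by rewrite mulmx_base.
pose G := invmx (F *m F^T); pose H := invmx (C^T *m C).
have GK : F *m F^T *m G = 1%:M by apply: mulmxV.
have HK : H *m (C^T *m C) = 1%:M by apply: mulVmx.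
have GT : G^T = G by rewrite trmx_inv trmx_mul trmxK.
have HT : H^T = H by rewrite trmx_inv trmx_mul trmxK.
clearbody C F G H; set r := \rank A in C F G H uF uC AE GK HK GT HT.
clearbody r; subst A.
have AX : C *m F *m (F^T *m G *m H *m C^T) = C *m H *m C^T.
  by rewrite -!mulmxA (mulmxA F) (mulmxA (F *m _)) GK mul1mx.
have XA : (F^T *m G *m H *m C^T) *m (C *m F) = F^T *m G *m F.
  by rewrite -!mulmxA (mulmxA C^T) (mulmxA H) HK mul1mx.
exists (F^T *m G *m H *m C^T); apply/penroseP; split.
- by rewrite AX -!mulmxA (mulmxA C^T) (mulmxA H) HK mul1mx.
- by rewrite XA -!mulmxA (mulmxA F) (mulmxA (F *m _)) GK mul1mx.
- by rewrite AX !trmx_mul trmxK HT mulmxA.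
- by rewrite XA !trmx_mul trmxK GT mulmxA.
Qed.

Lemma penrose_unique m n (A : 'M[R]_(m, n)) (X Y : 'M[R]_(n, m)) :
  penrose A X -> penrose A Y -> X = Y.
Proof.
move=> /penroseP[AXA XAX AXT XAT] /penroseP[AYA YAY AYT YAT].
have AXY : A *m X = A *m Y.
  by rewrite -AXT -{1}AYA -mulmxA trmx_mul AXT AYT mulmxA AXA.
have XYA : X *m A = Y *m A.
  by rewrite -XAT -{1}AYA -mulmxA mulmxA trmx_mul XAT YAT -mulmxA (mulmxA A) AXA.
by rewrite -XAX -mulmxA AXY mulmxA XYA YAY.
Qed.

Definition mpinv m n (A : 'M[R]_(m, n)) : 'M[R]_(n, m) :=
  xchoose (penrose_exists A).

Lemma mpinvP m n (A : 'M[R]_(m, n)) : penrose A (mpinv A).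
Proof. exact: xchooseP. Qed.

Lemma mpinv_eq m n (A : 'M[R]_(m, n)) (X : 'M[R]_(n, m)) :
  penrose A X -> mpinv A = X.
Proof. exact: penrose_unique (mpinvP A). Qed.

End MoorePenrose.

Section Graph.
Variable V : finType.
Implicit Type e : rel V.

Definition simple_graph e : Prop := symmetric e /\ irreflexive e.

Definition connected_graph e : Prop := forall x y : V, connect e x y.

Definition edge_set e : {set {set V}} :=
  [set S | [exists x, exists y, e x y && (S == [set x; y])]].

Definition degree e (u : V) : nat := #|[set w | e u w]|.

Variable R : rcfType.

(* pi(u) = d_u / (2m) *)
Definition stationary e (u : V) : R :=
  (degree e u)%:R / (2 * #|edge_set e|)%:R.

(* The matrices below are written in the labelling lab of the nodes. *)
Definition adjmx e n (lab : 'I_n -> V) : 'M[R]_n :=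
  \matrix_(i, j) (e (lab i) (lab j))%:R.

Definition degmx e n (lab : 'I_n -> V) : 'M[R]_n :=
  diag_mx (\row_i (degree e (lab i))%:R).

(* D^{-1/2} for a diagonal matrix D with positive diagonal *)
Definition diag_invsqrt n (D : 'M[R]_n) : 'M[R]_n :=
  diag_mx (\row_i (Num.sqrt (D i i))^-1).

Definition norm_laplacian e n (lab : 'I_n -> V) : 'M[R]_n :=
  1%:M - diag_invsqrt (degmx e lab) *m adjmx e lab
           *m diag_invsqrt (degmx e lab).

Definition stationary_vec e n (lab : 'I_n -> V) : 'cV[R]_n :=
  \col_i stationary e (lab i).

End Graph.

Arguments stationary {V} R e u.
Arguments adjmx {V} R e {n} lab.
Arguments degmx {V} R e {n} lab.
Arguments norm_laplacian {V} R e {n} lab.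
Arguments stationary_vec {V} R e {n} lab.

(* In a labelling by 'I_(k + 1) the last node is rshift k ord0, so deleting
   its row and column keeps the upper (left) block. *)
Definition del_last_mx (R : Type) k (M : 'M[R]_(k + 1)) : 'M[R]_k := ulsubmx M.
Definition del_last_vec (R : Type) k (x : 'cV[R]_(k + 1)) : 'cV[R]_k :=
  usubmx x.

(* Main.v *)
Require Import Defs.
From HB Require Import structures.
From mathcomp Require Import all_boot all_order all_algebra.
From mathcomp Require Import ring.
Import Order.TTheory GRing.Theory Num.Theory.
Local Open Scope ring_scope.

(** The vector [s = sqrt pi] is a unit vector spanning the kernel of the
    symmetric matrix [L], and its last entry is nonzero.  Put [P = 1 - s s^T]
    and let [B] be its first [k] columns; the claimed matrix is
    [X = B Lv^-1 B^T].  Since [L s = 0], the last row of [L] is a combination of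
    the others, which yields [L X = P]; by symmetry [X L = P], and the Penrose
    conditions follow.  Invertibility of [Lv] comes from the Dirichlet form: if
    [y] extended by [0] at [v] is killed by [L], then [y / sqrt d] is constant
    along edges, hence vanishes everywhere since it vanishes at [v]. *)

(** * Linear algebra: pseudo-inverse from an invertible principal block and a kernel vector *)

Lemma mpinv_bordered (R : realFieldType) k (L : 'M[R]_(k + 1))
    (x : 'cV[R]_k) (c : R) :
    L^T = L -> L *m col_mx x c%:M = 0 -> x^T *m x + (c ^+ 2)%:M = 1%:M ->
    c != 0 -> ulsubmx L \in unitmx ->
  mpinv L = col_mx (1%:M - x *m x^T) (- (c *: x^T)) *m invmx (ulsubmx L)
              *m row_mx (1%:M - x *m x^T) (- (c *: x)).
Proof.
move=> LT Ls s1 c0 uL.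
set B := col_mx _ _; set M := invmx _; set s := col_mx x c%:M in Ls.
have BT : row_mx (1%:M - x *m x^T) (- (c *: x)) = B^T.
  by rewrite tr_col_mx !linearB /= trmx1 trmx_mul trmxK !linearN !linearZ /= trmxK.
have MT : M^T = M by rewrite trmx_inv trmx_ulsub LT.
have BE : B = col_mx 1%:M 0 - s *m x^T.
  by rewrite mul_col_mx opp_col_mx add_col_mx add0r mul_scalar_mx.
have LE : L *m col_mx 1%:M 0 = col_mx (ulsubmx L) (dlsubmx L).
  by rewrite -{1}[L]submxK mul_block_col !mulmx0 !addr0 !mulmx1.
(* The left block of [s^T *m L = 0] says that [x^T] times the upper block plus [c] times the lower
   one is zero; multiply by [M] and divide by [c]. *)
have dlM : dlsubmx L *m M = - (c^-1 *: x^T).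
  have : s^T *m L = 0 by rewrite -LT -trmx_mul Ls trmx0.
  rewrite -[L in _ *m L]submxK tr_col_mx mul_row_block -row_mx0.
  case/eq_row_mx=> + _; rewrite tr_scalar_mx mul_scalar_mx.
  move=> /(congr1 (mulmx^~ M)); rewrite mul0mx mulmxDl mulmxK // -scalemxAl.
  move/eqP; rewrite addrC addr_eq0 => /eqP/(congr1 ( *:%R c^-1)).
  by rewrite scalerA mulVf // scale1r scalerN.
(* As [L] kills [s], [L *m B] is just the first [k] columns of [L], so [L *m B *m M] stacks the
   identity on [dlM]. What remains is a blockwise comparison using [x^T *m x = 1 - c ^+ 2]. *)
have LX : L *m (B *m M *m B^T) = 1%:M - s *m s^T.
  rewrite !mulmxA BE mulmxBr mulmxA Ls mul0mx subr0 LE -BE mul_col_mx.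
  rewrite mulmxV // dlM -BT mul_col_row tr_col_mx mul_col_row.
  rewrite -[1%:M in RHS]submxK opp_block_mx add_block_mx.
  have xx : x^T *m x = (1 - c ^+ 2)%:M.
    by rewrite raddfB /= -s1 addrK.
  rewrite scalar_mx_block block_mxKul block_mxKur block_mxKdl block_mxKdr.
  rewrite !mul1mx tr_scalar_mx mul_mx_scalar mul_scalar_mx !add0r.
  congr block_mx.
    (* Lower left block: the coefficient is [c^-1 * (1 - (1 - c ^+ 2)) = c]. *)
    rewrite mulNmx -scalemxAl mulmxBr mulmx1 mulmxA xx mul_scalar_mx.
    rewrite -{1}[x^T]scale1r -scalerBl scalerA; congr (- (_ *: _)).
    by field.
  rewrite mulmxN mulNmx opprK -scalemxAl -scalemxAr xx scalerA mulVf // scale1r.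
  by rewrite -scalar_mxM raddfB /= expr2.
set X := B *m M *m B^T in LX *.
have XT : X^T = X by rewrite /X !trmx_mul trmxK MT mulmxA.
have PT : (1%:M - s *m s^T)^T = 1%:M - s *m s^T.
  by rewrite linearB /= trmx1 trmx_mul trmxK.
have XL : X *m L = 1%:M - s *m s^T by rewrite -PT -LX trmx_mul LT XT.
have sL : s^T *m L = 0 by rewrite -LT -trmx_mul Ls trmx0.
have ss : s^T *m s = 1%:M.
  by rewrite tr_col_mx mul_row_col tr_scalar_mx -scalar_mxM -expr2.
have sB : s^T *m B = 0.
  rewrite BE mulmxBr mulmxA ss mul1mx tr_col_mx mul_row_col mulmx1 mulmx0 addr0.
  exact: subrr.
(* Both products equal the projection [1 - s *m s^T], which fixes [L] because [s^T *m L = 0] and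
   fixes [X] because [s^T *m B = 0]. *)
apply: mpinv_eq; rewrite BT; apply/penroseP; split; rewrite -/X ?LX ?XL //.
- by rewrite mulmxBl mul1mx -mulmxA sL mulmx0 subr0.
- by rewrite mulmxBl mul1mx /X !mulmxA -(mulmxA s) sB mulmx0 !mul0mx subr0.
Qed.

(** * Degrees, edge counting and the Dirichlet form *)

Section GraphFacts.
Variables (V : finType) (e : rel V).

Lemma degreeE u : degree e u = (\sum_w e u w)%N.
Proof.
rewrite /degree -sum1_card big_mkcond; apply: eq_bigr => w _.
by rewrite inE; case: (e u w).
Qed.

(** Both sides count ordered adjacent pairs, grouped on the right by their underlying edge. *)
Lemma handshake : simple_graph e -> (\sum_u degree e u = 2 * #|edge_set e|)%N.
Proof.
case=> e_sym e_irr.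
have -> : (\sum_u degree e u = \sum_(p : V * V | e p.1 p.2) 1)%N.
  rewrite -(pair_big_dep xpredT e (fun _ _ => 1)) /=.
  by apply: eq_bigr => u _; rewrite sum1dep_card.
rewrite (partition_big (fun p : V * V => [set p.1; p.2]) (mem (edge_set e))) /=; last first.
  move=> [x y] /= exy; rewrite inE; apply/existsP; exists x; apply/existsP.
  by exists y; rewrite exy eqxx.
rewrite mulnC -sum_nat_const; apply: eq_bigr => S.
rewrite inE => /existsP[a /existsP[b /andP[eab /eqP ->]]].
have ab : a != b by apply: contraTneq eab => ->; rewrite e_irr.
(* The fibre over an edge consists of its two orientations, distinct since there are no loops. *)
rewrite sum1dep_card -[RHS](_ : #|[set (a, b); (b, a)]| = 2); last first.
  by rewrite cards2 xpair_eqE (negPf ab).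
apply: eq_card => -[x y]; rewrite !inE !xpair_eqE /=.
apply/andP/orP => [[exy /eqP Exy]|].
  have xy : x != y by apply: contraTneq exy => ->; rewrite e_irr.
  have := set21 x y; have := set22 x y; rewrite Exy !inE.
  move=> /orP[] /eqP Ey /orP[] /eqP Ex; subst x y.
  - by rewrite eqxx in xy.
  - by right; rewrite !eqxx.
  - by left; rewrite !eqxx.
  - by rewrite eqxx in xy.
case=> /andP[/eqP -> /eqP ->]; first by rewrite eab eqxx.
by rewrite e_sym eab setUC eqxx.
Qed.

(** A path from [u] to some other vertex must start with a neighbour of [u]. *)
Lemma degree_gt0 u : connected_graph e -> (2 <= #|V|)%N -> (0 < degree e u)%N.
Proof.
move=> e_conn /card_gt1P[a [b [_ _ ab]]].
have [w uw] : exists w, w != u.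
  case: (eqVneq a u) => [au|]; last by exists a.
  by exists b; rewrite -au eq_sym.
have /connectP[[|w' p] /= + wE] := e_conn u w; first by rewrite wE eqxx in uw.
by case/andP=> euw' _; apply/card_gt0P; exists w'; rewrite inE.
Qed.

Variable R : rcfType.

Lemma dirichlet_form (f : V -> R) : symmetric e ->
  \sum_x \sum_y (e x y)%:R * (f x - f y) ^+ 2 =
  2 * (\sum_x (degree e x)%:R * f x ^+ 2
         - \sum_x \sum_y (e x y)%:R * (f x * f y)).
Proof.
move=> e_sym.
(* Writing the second weight as [e y x] makes its double sum equal to the first after exchanging the
   summations. *)
have E x y : (e x y)%:R * (f x - f y) ^+ 2 =
    (e x y)%:R * f x ^+ 2 + (e y x)%:R * f y ^+ 2 - 2 * ((e x y)%:R * (f x * f y)).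
  by rewrite (e_sym y x); ring.
under eq_bigr do (under eq_bigr do rewrite E; rewrite sumrB big_split /= -mulr_sumr).
rewrite sumrB big_split /= -mulr_sumr.
rewrite [X in _ + X - _]exchange_big /= -mulr2n -[_ *+ 2 in LHS]mulr_natl -mulrBr.
congr (_ * (_ - _)); apply: eq_bigr => x _.
by rewrite -mulr_suml -natr_sum -degreeE.
Qed.

(** A vanishing sum of nonnegative terms forces [f] to agree across each edge, hence along each
    path. *)
Lemma dirichlet_form_eq0 (f : V -> R) : connected_graph e ->
  \sum_x \sum_y (e x y)%:R * (f x - f y) ^+ 2 = 0 -> forall x y, f x = f y.
Proof.
move=> e_conn S0.
have ge0 x y : 0 <= (e x y)%:R * (f x - f y) ^+ 2 by rewrite mulr_ge0 ?sqr_ge0.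
have fe x y : e x y -> f x = f y.
  move=> exy; apply/eqP; rewrite -subr_eq0 -sqrf_eq0; apply/eqP.
  have Sx : \sum_y (e x y)%:R * (f x - f y) ^+ 2 = 0.
    by apply: (psumr_eq0P _ S0) => // z _; apply: sumr_ge0.
  have /(_ y isT) := psumr_eq0P (fun z _ => ge0 x z) Sx.
  by rewrite exy mul1r.
move=> x y; have /connectP[p + ->] := e_conn x y.
by elim: p x => //= z p IHp x /andP[/fe -> /IHp].
Qed.

(** * The normalized Laplacian in a labelling: entries, kernel, quadratic form *)

Section Labelled.
Variables (n : nat) (lab : 'I_n -> V).

Lemma norm_laplacianE i j : norm_laplacian R e lab i j =
  (i == j)%:R - (e (lab i) (lab j))%:R / Num.sqrt (degree e (lab i))%:R
                  / Num.sqrt (degree e (lab j))%:R.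
Proof.
rewrite /norm_laplacian /diag_invsqrt mul_diag_mx mul_mx_diag !mxE !eqxx !mulr1n.
by congr (_ - _ * _); rewrite mulrC.
Qed.

Lemma norm_laplacian_sym : symmetric e ->
  (norm_laplacian R e lab)^T = norm_laplacian R e lab.
Proof.
move=> e_sym; apply/matrixP=> i j; rewrite mxE !norm_laplacianE eq_sym e_sym.
by rewrite mulrAC.
Qed.

Hypothesis lab_bij : bijective lab.
Hypothesis deg_gt0 : forall u, (0 < degree e u)%N.

Let rd u : R := Num.sqrt (degree e u)%:R.

Let rd_neq0 u : rd u != 0.
Proof. by rewrite sqrtr_eq0 -ltNge ltr0n deg_gt0. Qed.

Let rd_sqr u : rd u ^+ 2 = (degree e u)%:R.
Proof. by rewrite sqr_sqrtr ?ler0n. Qed.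

Lemma sum_lab (F : V -> R) : \sum_i F (lab i) = \sum_u F u.
Proof. by rewrite (reindex lab) //; apply: onW_bij. Qed.

Lemma norm_laplacian_kernel :
  norm_laplacian R e lab *m map_mx Num.sqrt (stationary_vec R e lab) = 0.
Proof.
apply/colP=> i; rewrite !mxE.
(* [t] is the common factor in [sqrt pi = rd * t]. The factor [rd (lab j)] then cancels in the
   adjacency term, so summing over [j] only counts the neighbours of [lab i]. *)
pose t : R := Num.sqrt (2 * #|edge_set e|)%:R^-1.
have E j : norm_laplacian R e lab i j
             * map_mx Num.sqrt (stationary_vec R e lab) j 0 =
    (i == j)%:R * (rd (lab j) * t) - (e (lab i) (lab j))%:R * (t / rd (lab i)).
  rewrite norm_laplacianE !mxE /stationary sqrtrM ?ler0n // -/t -!/(rd _).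
  by field; rewrite !rd_neq0.
under eq_bigr do rewrite E.
rewrite sumrB -mulr_suml (sum_lab (fun u => (e (lab i) u)%:R)) -natr_sum -degreeE.
rewrite (bigD1 i) //= eqxx mul1r big1 => [|j /negPf ij]; last first.
  by rewrite eq_sym ij mul0r.
by rewrite -rd_sqr; field; rewrite rd_neq0.
Qed.

(** Substituting [y = D^{1/2} f] cancels the normalization and leaves the unnormalized Laplacian
    form in [f]. *)
Lemma norm_laplacian_form (y : 'I_n -> R) (f : V -> R) : symmetric e ->
    (forall i, y i = rd (lab i) * f (lab i)) ->
  2 * \sum_i \sum_j y i * norm_laplacian R e lab i j * y j =
  \sum_u \sum_w (e u w)%:R * (f u - f w) ^+ 2.
Proof.
move=> e_sym yE; rewrite dirichlet_form //; congr (_ * _).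
have E i j : y i * norm_laplacian R e lab i j * y j =
   (i == j)%:R * (y i * y j)
     - (e (lab i) (lab j))%:R * (f (lab i) * f (lab j)).
  by rewrite norm_laplacianE !yE -!/(rd _); field; rewrite !rd_neq0.
under eq_bigr do (under eq_bigr do rewrite E; rewrite sumrB).
rewrite sumrB; congr (_ - _).
  rewrite -sum_lab; apply: eq_bigr => i _.
  rewrite (bigD1 i) //= eqxx mul1r big1 => [|j /negPf ij]; last first.
    by rewrite eq_sym ij mul0r.
  by rewrite yE -rd_sqr addr0; ring.
rewrite -sum_lab; apply: eq_bigr => i _.
by rewrite -(sum_lab (fun w => (e (lab i) w)%:R * _)).
Qed.

End Labelled.

Lemma norm_laplacian_del_last_unit k (lab : 'I_(k + 1) -> V) :
    symmetric e -> connected_graph e -> (forall u, (0 < degree e u)%N) ->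
    bijective lab ->
  del_last_mx (norm_laplacian R e lab) \in unitmx.
Proof.
move=> e_sym e_conn deg_gt0 lab_bij; set L := norm_laplacian R e lab.
rewrite -row_free_unit -kermx_eq0; apply/eqP/row_matrixP => i0; rewrite row0.
set y := row i0 _.
have yL : y *m ulsubmx L = 0 by rewrite /y -row_mul mulmx_ker row0.
clearbody y; pose z : 'rV[R]_(k + 1) := row_mx y 0.
have [inv labK invK] := lab_bij.
pose f u := z 0 (inv u) / Num.sqrt (degree e u)%:R.
have rd0 u : Num.sqrt (degree e u)%:R != 0 :> R.
  by rewrite sqrtr_eq0 -ltNge ltr0n.
have zf i : z 0 i = Num.sqrt (degree e (lab i))%:R * f (lab i).
  by rewrite /f labK mulrC divfK.
have := norm_laplacian_form _ lab lab_bij deg_gt0 (z 0) f e_sym zf.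
rewrite (_ : \sum_i \sum_j _ = (z *m L *m z^T) 0 0); last first.
  rewrite mxE exchange_big; apply: eq_bigr => j _ /=.
  by rewrite !mxE mulr_suml.
(* The zero last entry of [z] reduces [z *m L *m z^T] to [y *m ulsubmx L *m y^T], which vanishes;
   the form being zero is enough for [f] to be constant. *)
rewrite /z -[L]submxK mul_row_block tr_row_mx mul_row_col trmx0 mulmx0 addr0.
rewrite mul0mx addr0 yL mul0mx mxE mulr0.
move/esym/(dirichlet_form_eq0 f e_conn)=> fc.
apply/rowP=> i; rewrite mxE.
have -> : y 0 i = z 0 (lshift 1 i) by rewrite row_mxEl.
(* Compare with the deleted node, where [z], and so [f], is zero. *)
rewrite zf (fc _ (lab (rshift k ord0))) /f labK row_mxEr mxE mul0r mulr0.
by [].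
Qed.

End GraphFacts.

Theorem theorem3p2 (R : rcfType) (V : finType) (e : rel V)
    (e_simple : simple_graph e) (e_conn : connected_graph e)
    (V_ge2 : (2 <= #|V|)%N) (v : V)
    (k : nat) (lab : 'I_(k + 1) -> V) (lab_bij : bijective lab)
    (lab_last : lab (rshift k ord0) = v) :
  let L : 'M[R]_(k + 1) := norm_laplacian R e lab in
  let Lv : 'M[R]_k := del_last_mx L in
  let spi_v : 'cV[R]_k :=
    map_mx Num.sqrt (del_last_vec (stationary_vec R e lab)) in
  let spiv : R := Num.sqrt (stationary R e v) in
  Lv \in unitmx /\
  mpinv L =
    col_mx (1%:M - spi_v *m spi_v^T) (- (spiv *: spi_v^T))
      *m invmx Lv
      *m row_mx (1%:M - spi_v *m spi_v^T) (- (spiv *: spi_v)).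
Proof.
move=> L Lv spi_v spiv.
have deg_gt0 u : (0 < degree e u)%N by apply: degree_gt0.
have [e_sym _] := e_simple.
have uLv : Lv \in unitmx by apply: norm_laplacian_del_last_unit.
(* The degree of [v] alone makes the degree sum positive, so the division by [2m] is genuine. *)
have m_gt0 : (0 < 2 * #|edge_set e|)%N.
  by rewrite -handshake // (bigD1 v) //= ltn_addr.
have pi_gt0 u : 0 < stationary R e u by rewrite divr_gt0 ?ltr0n.
have sE : col_mx spi_v spiv%:M = map_mx Num.sqrt (stationary_vec R e lab).
  rewrite -[stationary_vec _ _ _]vsubmxK map_col_mx; congr col_mx.
  by apply/colP=> i; rewrite !ord1 !mxE eqxx mulr1n lab_last.
split=> //; apply: mpinv_bordered => //.
- exact: norm_laplacian_sym.
- by rewrite sE norm_laplacian_kernel.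
(* The squared norm of [sqrt pi] is the total mass of [pi], which is 1 by the handshake identity. *)
- have -> : spi_v^T *m spi_v + (spiv ^+ 2)%:M
      = (col_mx spi_v spiv%:M)^T *m col_mx spi_v spiv%:M.
    by rewrite tr_col_mx mul_row_col tr_scalar_mx -scalar_mxM -expr2.
  rewrite sE; apply/matrixP=> i j; rewrite !ord1 !mxE eqxx mulr1n.
  under eq_bigr do rewrite !mxE -expr2 sqr_sqrtr ?ltW //.
  rewrite (sum_lab _ _ _ lab lab_bij (stationary R e)) -mulr_suml -natr_sum handshake //.
  by rewrite divff // pnatr_eq0 -lt0n.
- by rewrite sqrtr_eq0 -ltNge.
Qed.
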